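(* Let $X$ and $Y$ be (disjoint) nonempty sets of any cardinality and let $d$ be a degree function on the free nonunitary semigroup $F=\langle X,Y\rangle$ on the free generating set $X\cup Y$, such that $d(x)>0$ and $d(y)<0$ for all $x\in X$, $y\in Y$, and such that, whenever a finite sum $$\sum_{x_i\in X}p_i\,d(x_i)+\sum_{y_j\in Y}q_j\,d(y_j)=0$$ for some $p_i,q_j\in\mathbb{Q}$ with $p_i,q_j\ge 0$, then $p_i=q_j=0$ for all $x_i\in X$, $y_j\in Y$. Let $a,b\in\mathbb{R}$, $a,b>0$, and suppose there exist $x_0\in X$ and $y_0\in Y$ such that $d(x_0)\le a$ and $d(y_0)\ge -b$. Let $$S=F/\mathrm{id}_F\{w\in F\mid |d(w)|\ge a+b\}.$$ Then $S$ is not nilpotent, and $S$ is the union of the subsemigroups $$S_+=\{s\in S\setminus\{0\}\mid d(s)>0\}\cup\{0\},\qquad S_-=\{s\in S\setminus\{0\}\mid d(s)<0\}\cup\{0\},$$ which are locally nilpotent, whose finitely generated ideals are nilpotent, and which satisfy $S_+\cap S_-=\{0\}$.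
   Context: The free nonunitary semigroup on a set consists of all nonempty finite words under concatenation. A degree function on it is a map $d$ to $\mathbb{R}$ with $d(w_1w_2)=d(w_1)+d(w_2)$ for all words $w_1,w_2$ (so it is determined by arbitrary values on the generators). $\mathrm{id}_F(W)$ is the two-sided ideal of $F$ generated by $W$. For an ideal $\mathbb{I}$ of $F$, the Rees factor $F/\mathbb{I}$ is the semigroup $(F\setminus\mathbb{I})\cup\{0\}$ in which all elements of $\mathbb{I}$ are identified with $0$; $d$ induces a degree function on its nonzero elements. A semigroup $T$ with zero is nilpotent if for some $n\geq 1$ all products of $n$ elements of $T$ are $0$; it is locally nilpotent if every finitely generated subsemigroup of it is nilpotent. ''Finitely generated ideals of $S_{\pm}$'' means ideals of the semigroup $S_\pm$ itself generated by finite subsets of $S_\pm$. *)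

(* Defs.v *)
From HB Require Import structures.
From mathcomp Require Export all_boot all_order all_algebra.
From mathcomp Require Export all_classical reals.

Set Implicit Arguments.
Unset Strict Implicit.
Unset Printing Implicit Defensive.

Import Order.TTheory GRing.Theory Num.Theory.

Local Open Scope classical_set_scope.
Local Open Scope ring_scope.

HB.mixin Record Semigroup_hasAbsorbing T of Semigroup T := {
  szero : T;
  smul0s : forall x : T, (szero * x)%g = szero;
  smuls0 : forall x : T, (x * szero)%g = szero
}.

#[short(type="semigroup0Type")]
HB.structure Definition Semigroup0 := {T of Semigroup_hasAbsorbing T & Semigroup T}.

Section Semigroups.
Variable T : semigroupType.
Implicit Types A G I : set T.

Definition subsemigroup A := forall x y, A x -> A y -> A (x * y)%g.

(* Empty if [G] is empty: subsemigroups are not required to be inhabited. *)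
Definition subsemigroup_gen G : set T := smallest subsemigroup G.

(* [A] is meant to be a subsemigroup; [A = setT] gives the ideals of [T]. *)
Definition ideal_of A I :=
  I `<=` A /\ forall x i, A x -> I i -> I (x * i)%g /\ I (i * x)%g.

Definition ideal_gen A G : set T := smallest (ideal_of A) G.

Lemma ideal_genT_ideal G : ideal_of setT (ideal_gen setT G).
Proof.
split=> // x i _ Gi; split=> J [iJ GJ].
  exact: (iJ.2 x i I (Gi J (conj iJ GJ))).1.
exact: (iJ.2 x i I (Gi J (conj iJ GJ))).2.
Qed.

End Semigroups.

Section Nilpotency.
Variable T : semigroup0Type.
Implicit Types A G : set T.

(* [foldl *%g x s] is the product of the [n] factors listed in [x :: s].  The
   zero is that of [T], also when [A] is a subsemigroup not known to contain
   it. *)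
Definition nilpotent_in A := exists2 n : nat, (1 <= n)%N &
  forall (x : T) (s : seq T), [set` x :: s] `<=` A -> size (x :: s) = n ->
    foldl (fun u v => u * v)%g x s = szero.

Definition locally_nilpotent A := forall G,
  finite_set G -> G `<=` A -> nilpotent_in (subsemigroup_gen G).

End Nilpotency.

(* The free nonunitary semigroup on [A]. *)
Record word (A : Type) := Word {
  letters :> seq A;
  _ : ~~ nilp letters
}.

HB.instance Definition _ (A : Type) := [isSub for @letters A].
HB.instance Definition _ (A : Type) := gen_eqMixin (word A).
HB.instance Definition _ (A : Type) := gen_choiceMixin (word A).

Section FreeSemigroup.
Variable A : Type.
Implicit Types u v : word A.

Lemma word_cat_subproof u v : ~~ nilp (letters u ++ letters v).
Proof. by case: u => -[]. Qed.

Definition word_mul u v := Word (word_cat_subproof u v).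

Lemma word_mulA : associative word_mul.
Proof. by move=> u v w; apply: val_inj; rewrite /= catA. Qed.

HB.instance Definition _ := isSemigroup.Build (word A) word_mulA.

Definition gen (x : A) : word A := @Word A [:: x] isT.

End FreeSemigroup.

Definition is_degree (R : realType) (F : semigroupType) (d : F -> R) :=
  forall u v : F, d (u * v)%g = d u + d v.

(* [Some w] is the class of [w] outside [I], and [None] is the zero.  The proof
   [idI] that [I] is an ideal is a parameter of the type so that associativity
   is available to instance inference. *)
Definition rees (F : semigroupType) (I : set F) (idI : ideal_of setT I) : Type :=
  option (set_type (~` I)).

Section ReesFactor.
Variables (F : semigroupType) (I : set F) (idI : ideal_of setT I).
Local Notation S := (rees idI).

HB.instance Definition _ := Choice.on S.

Definition rees_proj (w : F) : S := insub w.

Definition rees_mul (s t : S) : S :=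
  match s, t with
  | Some u, Some v => rees_proj (val u * val v)%g
  | _, _ => None
  end.

Lemma rees_proj_eq0 w : I w -> rees_proj w = None.
Proof. by move=> Iw; apply: insubN; rewrite notin_setE /= => /(_ Iw). Qed.

Lemma rees_projM u v : rees_proj (u * v)%g = rees_mul (rees_proj u) (rees_proj v).
Proof.
rewrite {2}/rees_proj; case: insubP => [u' _ <-|].
  rewrite {2}/rees_proj; case: insubP => [v' _ <- //|].
  rewrite notin_setE /= => /contrapT Iv.
  exact/rees_proj_eq0/(idI.2 _ _ Logic.I Iv).1.
rewrite notin_setE /= => /contrapT Iu.
exact/rees_proj_eq0/(idI.2 _ _ Logic.I Iu).2.
Qed.

Lemma rees_mulA : associative rees_mul.
Proof.
have projK (u : set_type (~` I)) : Some u = rees_proj (val u).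
  by rewrite /rees_proj valK.
have mul0r s : rees_mul s None = None by case: s.
by case=> [u|//] [v|//] [w|]; rewrite ?mul0r // !projK -!rees_projM mulgA.
Qed.

HB.instance Definition _ := isSemigroup.Build S rees_mulA.

Lemma rees_mul0s (s : S) : ((None : S) * s)%g = None. Proof. by []. Qed.

Lemma rees_muls0 (s : S) : (s * (None : S))%g = None. Proof. by case: s. Qed.

HB.instance Definition _ :=
  Semigroup_hasAbsorbing.Build S rees_mul0s rees_muls0.

(* The degree induced by [d] on the nonzero elements; the value [0] at the zero
   of [S] is a junk value. *)
Definition rees_deg (R : realType) (d : F -> R) (s : S) : R :=
  if s is Some w then d (val w) else 0.

Definition rees_pos (R : realType) (d : F -> R) : set S :=
  [set s | s <> szero /\ 0 < rees_deg d s] `|` [set szero].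

Definition rees_neg (R : realType) (d : F -> R) : set S :=
  [set s | s <> szero /\ rees_deg d s < 0] `|` [set szero].

End ReesFactor.

(* Main.v *)
(* A word is nonzero in S iff all its factors have degree of absolute value less
   than a + b.  Elements of S_+ of degree at least eps > 0 (together with 0) form
   both a subsemigroup and an ideal of S_+, and a product of more than
   (a + b) / eps of them must vanish; the finitely many nonzero generators have
   degrees bounded below by a common eps.  The case of S_- is obtained from -d.
   For the non-nilpotency of S one builds arbitrarily long words in x0, y0 whose
   prefixes all have degree in [-b, a[ : append x0 when the current degree is
   negative, and y0 otherwise. *)
Require Import Defs.
From mathcomp Require Import lra.
Import Order.TTheory GRing.Theory Num.Theory.
Local Open Scope classical_set_scope.
Local Open Scope ring_scope.

Set Implicit Arguments.
Unset Strict Implicit.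
Unset Printing Implicit Defensive.

(** * Degrees and nilpotency in Rees factors *)

Lemma nilpotent_inS (T : semigroup0Type) (A B : set T) :
  A `<=` B -> nilpotent_in B -> nilpotent_in A.
Proof.
move=> AB [n n_gt0 nilB]; exists n => // x s xsA; apply: nilB.
exact: subset_trans AB.
Qed.

Lemma rees_proj_eq0_ideal (F : semigroupType) (I : set F)
    (idI : ideal_of setT I) (w : F) : rees_proj idI w = szero -> I w.
Proof.
by rewrite /rees_proj; case: insubP => //; rewrite notin_setE => /contrapT.
Qed.

Section ReesDegree.
Variables (R : realType) (F : semigroupType) (I : set F).
Variables (idI : ideal_of setT I) (d : F -> R).
Hypothesis hd : is_degree d.
Local Notation S := (rees idI).
Implicit Types (s t : S) (G : set S).

Lemma rees_deg_proj w : rees_proj idI w <> szero ->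
  rees_deg d (rees_proj idI w) = d w.
Proof. by rewrite /rees_proj; case: insubP => // u _ <-. Qed.

Lemma rees_mul_neq0 s t : (s * t)%g <> szero ->
  [/\ s <> szero, t <> szero &
      rees_deg d (s * t)%g = rees_deg d s + rees_deg d t].
Proof.
move=> st_neq0; split.
- by move=> s0; apply: st_neq0; rewrite s0 smul0s.
- by move=> t0; apply: st_neq0; rewrite t0 smuls0.
case: s t st_neq0 => [u|] [v|] //.
by move=> /rees_deg_proj ->; rewrite hd.
Qed.

Lemma rees_posM : subsemigroup (rees_pos d : set S).
Proof.
move=> s t sP tP; have [st0|st0] := pselect ((s * t)%g = szero); first by right.
have [s_neq0 t_neq0 dst] := rees_mul_neq0 st0.
case: sP => [[_ ds]|//]; case: tP => [[_ dt]|//].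
by left; split => //; rewrite dst addr_gt0.
Qed.

(** The implication keeps zero in the set, whatever its junk degree. *)
Definition rees_deg_ge (e : R) : set S := [set s | s <> szero -> e <= rees_deg d s].

Lemma rees_deg_ge_nilpotent (e c : R) : 0 < e ->
  (forall w, ~ I w -> d w < c) -> nilpotent_in (rees_deg_ge e).
Proof.
move=> e_gt0 dc.
(* The accumulator [s] stands for [k] factors already multiplied, which makes the induction on [l]
   go through. *)
have foldl_ge (l : seq S) k s : [set` l] `<=` rees_deg_ge e ->
    rees_deg_ge (e *+ k) s ->
    rees_deg_ge (e *+ (k + size l)) (foldl (fun u v => u * v)%g s l).
  elim: l k s => [|t l IHl] k s lA sk /=; first by rewrite addn0.
  rewrite addnS -addSn; apply: IHl => [u ul|].
    by apply: lA; rewrite /= inE ul orbT.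
  move=> /rees_mul_neq0[s0 t0 ->]; rewrite mulrSr lerD ?sk //.
  by apply: lA => //; rewrite /= mem_head.
(* The absolute value allows for a negative [c], and the successor makes the length positive. A
   nonzero product of that length would have degree at least [c]. *)
exists (Num.Def.archi_bound `|c / e|).+1 => // s l slA szl.
have /(_ (mem_head _ _)) sA := slA s.
have lA : [set` l] `<=` rees_deg_ge e.
  by move=> t tl; apply: slA; rewrite /= inE; apply/orP; right.
have := foldl_ge l 1%N s lA sA; rewrite add1n.
move: szl => /= ->.
case: (foldl _ _ _) => [w|//] /(_ _)/wrap[//|] /= dw.
have := dc (val w) (set_valP w); rewrite ltNge => /negP[].
apply: le_trans dw; rewrite -mulr_natr mulrC -ler_pdivrMr //.
apply: le_trans (ler_norm _) (le_trans (ltW (archi_boundP (normr_ge0 _))) _).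
by rewrite ler_nat.
Qed.

(** Take for [e] the minimum of 1 and the degrees of the nonzero elements of [G]; the 1 only serves
    to start the induction. *)
Lemma finite_rees_pos_ge G : finite_set G -> G `<=` rees_pos d ->
  exists2 e, 0 < e & G `<=` rees_deg_ge e.
Proof.
move=> /finite_seqP[l ->]; elim: l => [|s l IHl] lP; first by exists 1.
have [|e e_gt0 le] := IHl.
  by move=> t tl; apply: lP; rewrite /= inE; apply/orP; right.
have [[s0 ds]|s0] := lP s (mem_head _ _); last first.
  exists e => // t; rewrite /= inE => /predU1P[->//|]; exact: le.
exists (Num.min e (rees_deg d s)); first by rewrite lt_min e_gt0.
move=> t; rewrite /= inE => /predU1P[-> _|tl t0]; first by rewrite ge_min lexx orbT.
by rewrite ge_min (le t).
Qed.

Variable c : R.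
Hypothesis dc : forall w, ~ I w -> d w < c.

Lemma rees_pos_locally_nilpotent : locally_nilpotent (rees_pos d : set S).
Proof.
move=> G finG GP; have [e e_gt0 Ge] := finite_rees_pos_ge finG GP.
apply: nilpotent_inS (rees_deg_ge_nilpotent e_gt0 dc).
apply: smallest_sub => // s t se te /rees_mul_neq0[s0 t0 ->].
by apply: le_trans (se s0) _; rewrite lerDl (le_trans (ltW e_gt0)) ?te.
Qed.

Lemma rees_pos_ideal_nilpotent G : finite_set G -> G `<=` rees_pos d ->
  nilpotent_in (ideal_gen (rees_pos d) G).
Proof.
move=> finG GP; have [e e_gt0 Ge] := finite_rees_pos_ge finG GP.
(* [ideal_of] requires a subset of [rees_pos d], hence the intersection. A nonzero product with a
   factor from [rees_pos d] has a degree no smaller than that of the other factor. *)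
suff : ideal_gen (rees_pos d) G `<=` rees_pos d `&` rees_deg_ge e.
  move=> sub; apply: nilpotent_inS (rees_deg_ge_nilpotent e_gt0 dc).
  by move=> s /sub[].
apply: smallest_sub; last by move=> s Gs; split; [exact: GP|exact: Ge].
split=> [s []//|s t sP [tP te]].
have deg_ge0 : s <> szero -> 0 <= rees_deg d s.
  by case: sP => [[_ /ltW]|->].
split; (split; first exact: rees_posM) => /rees_mul_neq0[u0 v0 ->].
  by rewrite ler_wpDl ?deg_ge0 ?te.
by rewrite ler_wpDr ?deg_ge0 ?te.
Qed.

End ReesDegree.

(** Transfers the results on [rees_pos] to [rees_neg], since [- d] is again a degree. *)
Lemma rees_negE (R : realType) (F : semigroupType) (I : set F)
    (idI : ideal_of setT I) (d : F -> R) :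
  rees_neg d = rees_pos (fun w => - d w) :> set (rees idI).
Proof.
rewrite /rees_neg /rees_pos; congr (_ `|` _); apply/seteqP.
by split=> -[w|] [//= _ dw]; split=> //=; rewrite ?oppr_gt0 // -oppr_gt0.
Qed.

(** * Degrees of words, of their factors and of their prefixes *)

Section WordDegree.
Variables (R : realType) (A : Type) (d : word A -> R).
Hypothesis hd : is_degree d.

Lemma degree_word (w : word A) : d w = \sum_(x <- letters w) d (gen x).
Proof.
case: w => [[|x s] nil_xs] //.
elim: s x nil_xs => [|y s IHs] x nil_xs.
  by rewrite big_seq1; congr d; apply: val_inj.
have -> : Word nil_xs = (gen x * @Word A (y :: s) isT)%g by apply: val_inj.
by rewrite hd IHs [RHS]big_cons.
Qed.

(** The words with a factor of absolute degree at least [c] form an ideal that contains the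
    generators. Factors are sequences, so that [p] and [q] may be empty. *)
Lemma ideal_gen_factor (c : R) (w : word A) :
  ideal_gen setT [set w | c <= `|d w|] w ->
  exists p u q : seq A, letters w = p ++ u ++ q /\
    c <= `|\sum_(x <- u) d (gen x)|.
Proof.
pose J : set (word A) := [set w | exists p u q : seq A,
  letters w = p ++ u ++ q /\ c <= `|\sum_(x <- u) d (gen x)|].
suff : ideal_gen setT [set w | c <= `|d w|] `<=` J by apply.
apply: smallest_sub => [|v cv]; last first.
  by exists [::], (letters v), [::]; rewrite cats0 -degree_word.
split=> // u v _ [p [f [q [vE cf]]]]; split.
  by exists (letters u ++ p), f, q; rewrite -catA -vE.
by exists p, f, (q ++ letters u); rewrite [letters _]/= vE -!catA.
Qed.

End WordDegree.

(** A half-open interval of length [a + b] is what is wanted: two prefix sums lying in it differ by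
    strictly less than [a + b]. *)
Lemma bounded_walk (R : realType) (A : Type) (f : A -> R) (a b : R) (x y : A) :
  0 < a -> 0 <= b -> 0 <= f x <= a -> - b <= f y <= 0 ->
  forall n, exists2 s : seq A, size s = n &
    forall p q, s = p ++ q -> - b <= \sum_(z <- p) f z < a.
Proof.
move=> a_gt0 b_ge0 /andP[fx_ge0 fxa] /andP[fyb fy_le0].
elim=> [|n [s sz_s sP]].
  by exists [::] => // -[|//] q _; rewrite big_nil oppr_le0 b_ge0.
have /andP[bs sa] : - b <= \sum_(z <- s) f z < a.
  by apply: (sP s [::]); rewrite cats0.
(* Appending a letter creates only one new prefix, the whole sequence. *)
suff [z zP] : exists z, - b <= \sum_(t <- s) f t + f z < a.
  exists (rcons s z); first by rewrite size_rcons sz_s.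
  move=> p q; case/lastP: q => [|q t]; last first.
    by rewrite -rcons_cat => /rcons_inj[/sP].
  by rewrite cats0 => <-; rewrite -cats1 big_cat big_seq1.
have [s_lt0|s_ge0] := ltP (\sum_(t <- s) f t) 0; [exists x|exists y].
  by rewrite ler_wpDr //= -[a]add0r ltr_leD.
by rewrite -[- b]add0r lerD //= (le_lt_trans _ sa) // gerDl.
Qed.

(** * Independence of the generators' degrees *)

Lemma sum_undup_count (R : pzSemiRingType) (T : eqType) (f : T -> R) (s : seq T) :
  \sum_(x <- s) f x =
  \sum_(i < size (undup s)) (count_mem (tnth (in_tuple (undup s)) i) s)%:R
     * f (tnth (in_tuple (undup s)) i).
Proof.
rewrite -big_undup_iterop_count /= big_tnth.
by apply: eq_bigr => i _; rewrite mulr_natl.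
Qed.

Section Independence.
Variables (R : realType) (X Y : Type) (f : X -> R) (g : Y -> R).
Hypothesis hindep : forall (m n : nat) (x : 'I_m -> X) (y : 'I_n -> Y)
      (p : 'I_m -> rat) (q : 'I_n -> rat),
    injective x -> injective y ->
    (forall i, 0 <= p i) -> (forall j, 0 <= q j) ->
    \sum_(i < m) ratr (p i) * f (x i) + \sum_(j < n) ratr (q j) * g (y j) = 0 ->
    (forall i, p i = 0) /\ (forall j, q j = 0).

(** Grouping equal letters gives combinations of distinct letters whose coefficients, the
    multiplicities, are nonnegative rationals; by [hindep] all of them vanish. *)
Lemma indep_sum_eq0 (xs : seq X) (ys : seq Y) :
  \sum_(x <- xs) f x + \sum_(y <- ys) g y = 0 -> xs = [::] /\ ys = [::].
Proof.
have inj_tnth (T : eqType) (s : seq T) : injective (tnth (in_tuple (undup s))).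
  by apply/tuple_uniqP; exact: undup_uniq.
have count0 (T : eqType) (s : seq T) :
    (forall i, (count_mem (tnth (in_tuple (undup s)) i) s)%:R = 0 :> rat) ->
    s = [::].
  (* The first entry of [undup s], if there is one, occurs in [s] and so has nonzero
     multiplicity. *)
  move=> s0; apply: undup_nil; apply: size0nil; apply/eqP.
  rewrite -leqn0 leqNgt; apply/negP => s_gt0.
  have /eqP := s0 (Ordinal s_gt0); rewrite pnatr_eq0 -leqn0 leqNgt -has_count.
  by rewrite has_pred1 -mem_undup (mem_tnth _ (in_tuple _)).
pose mult (T : eqType) (s : seq T) i : rat :=
  (count_mem (tnth (in_tuple (undup s)) i) s)%:R.
(* Counting needs an equality test, which [{classic _}] supplies on the bare types [X] and [Y]. *)
rewrite (@sum_undup_count R {classic X} f xs).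
rewrite (@sum_undup_count R {classic Y} g ys) => sum0.
have [|||p0 q0] :=
  hindep (inj_tnth {classic X} xs) (inj_tnth {classic Y} ys)
    (p := mult {classic X} xs) (q := mult {classic Y} ys).
- by move=> i; rewrite ler0n.
- by move=> i; rewrite ler0n.
- by rewrite -[RHS]sum0; congr (_ + _); apply: eq_bigr => i _; rewrite /mult ratr_nat.
by split; [exact: (count0 {classic X})|exact: (count0 {classic Y})].
Qed.

End Independence.

(** The equation on sizes allows one to conclude that [s] is empty once [xs] and [ys] are. *)
Lemma sum_partition_inl_inr (R : nmodType) (X Y : Type) (h : X + Y -> R)
    (s : seq (X + Y)) :
  exists xs ys, [/\ size s = (size xs + size ys)%N &
  \sum_(z <- s) h z = \sum_(x <- xs) h (inl x) + \sum_(y <- ys) h (inr y)].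
Proof.
elim: s => [|[x|y] s [xs [ys [sz_s sE]]]].
- by exists [::], [::]; rewrite !big_nil addr0.
- by exists (x :: xs), ys; rewrite /= sz_s !big_cons sE addrA.
- by exists xs, (y :: ys); rewrite /= sz_s addnS !big_cons sE addrCA.
Qed.

(** * Non-nilpotency of [S] and its decomposition by the sign of the degree *)

Theorem theorem3 (R : realType) (X Y : Type) (d : word (X + Y)%type -> R) (a b : R)
  (hX : inhabited X) (hY : inhabited Y)
  (hd : is_degree d)
  (hdX : forall x : X, 0 < d (gen (inl x)))
  (hdY : forall y : Y, d (gen (inr y)) < 0)
  (hindep : forall (m n : nat) (x : 'I_m -> X) (y : 'I_n -> Y)
      (p : 'I_m -> rat) (q : 'I_n -> rat),
    injective x -> injective y ->
    (forall i, 0 <= p i) -> (forall j, 0 <= q j) ->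
    \sum_(i < m) ratr (p i) * d (gen (inl (x i)))
      + \sum_(j < n) ratr (q j) * d (gen (inr (y j))) = 0 ->
    (forall i, p i = 0) /\ (forall j, q j = 0))
  (ha : 0 < a) (hb : 0 < b)
  (hx0 : exists x0 : X, d (gen (inl x0)) <= a)
  (hy0 : exists y0 : Y, - b <= d (gen (inr y0))) :
  let W := [set w : word (X + Y)%type | a + b <= `|d w|] in
  let S : semigroup0Type := rees (ideal_genT_ideal W) in
  let Sp : set S := rees_pos d in
  let Sm : set S := rees_neg d in
  [/\ ~ nilpotent_in [set: S],
      [/\ subsemigroup Sp, subsemigroup Sm & Sp `|` Sm = [set: S]],
      locally_nilpotent Sp /\ locally_nilpotent Sm,
      (forall G : set S, finite_set G -> G `<=` Sp ->
         nilpotent_in (ideal_gen Sp G)) /\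
      (forall G : set S, finite_set G -> G `<=` Sm ->
         nilpotent_in (ideal_gen Sm G))
    & Sp `&` Sm = [set szero]].
Proof.
move=> W S Sp Sm.
(* Words are nonempty, so independence excludes degree zero; hence [Sp] and [Sm] cover [S]. *)
have d_neq0 w : d w <> 0.
  have [xs [ys [sz_w wE]]] := sum_partition_inl_inr (fun z => d (gen z)) (letters w).
  rewrite (degree_word hd) wE => /(indep_sum_eq0 hindep)[xs0 ys0].
  by case: w sz_w {wE} => -[//|? ?] ?; rewrite xs0 ys0.
have dW w : ~ ideal_gen setT W w -> `|d w| < a + b.
  move=> Ww; rewrite ltNge; apply/negP => abw; apply: Ww.
  exact: (@sub_gen_smallest _ (ideal_of setT) W).
have hdN : is_degree (fun w => - d w) by move=> u v; rewrite hd opprD.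
have dab w : ~ ideal_gen setT W w -> d w < a + b.
  by move=> /dW; apply: le_lt_trans; exact: ler_norm.
have dNab w : ~ ideal_gen setT W w -> - d w < a + b.
  by move=> /dW; apply: le_lt_trans; rewrite -normrN ler_norm.
have SmE : Sm = rees_pos (fun w => - d w) by exact: rees_negE.
split.
- move=> [n n_gt0 nilS].
  have [[x0 x0a] [y0 y0b]] := (hx0, hy0).
  have x0_bounds : 0 <= d (gen (inl x0)) <= a by rewrite x0a ltW.
  have y0_bounds : - b <= d (gen (inr y0)) <= 0 by rewrite y0b ltW.
  have [l sz_l lP] := bounded_walk (f := fun z => d (gen z))
    ha (ltW hb) x0_bounds y0_bounds n.
  case: l sz_l lP => [n0|z l sz_l lP]; first by rewrite -n0 in n_gt0.
  pose pr := rees_proj (ideal_genT_ideal W).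
  have foldlE (w : word (X + Y)) (k : seq (X + Y)) :
      foldl (fun u v => u * v)%g (pr w) [seq pr (gen t) | t <- k] =
      pr (foldl (fun u t => u * gen t)%g w k).
    elim: k w => //= t k IHk w; rewrite -IHk; congr foldl.
    by rewrite /pr rees_projM.
  have lettersE (w : word (X + Y)) k :
      letters (foldl (fun u t => u * gen t)%g w k) = letters w ++ k.
    by elim: k w => [|t k IHk] w /=; rewrite ?cats0 // IHk /= -catA.
  have := nilS (pr (gen z)) [seq pr (gen t) | t <- l].
  rewrite /= size_map => /(_ (fun _ _ => Logic.I) sz_l).
  (* A zero product puts the word [z :: l] in the ideal, so it has a factor [u] of absolute degree
     at least [a + b]. *)
  rewrite foldlE => /rees_proj_eq0_ideal/(ideal_gen_factor hd)[p [u [q []]]].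
  rewrite lettersE /= => lE.
  have /andP[bp pa] := lP p (u ++ q) lE.
  (* The degree of [u] is the difference of the prefix sums of [p ++ u] and [p], both in the
     half-open interval from [- b] to [a]. *)
  have := lP (p ++ u) q; rewrite -catA => /(_ lE); rewrite big_cat /=.
  move=> /andP[bpu pua]; rewrite leNgt => /negP[]; rewrite ltr_norml.
  by apply/andP; split; lra.
- split; [exact: rees_posM|by rewrite SmE; exact: rees_posM|].
  apply/seteqP; split=> // -[w|] _; last by left; right.
  have /eqP := @d_neq0 (val w); rewrite neq_lt => /orP[dw|dw].
    by right; left.
  by left; left.
- by split; [|rewrite SmE]; apply: rees_pos_locally_nilpotent; eassumption.
- split=> G; first exact: (rees_pos_ideal_nilpotent hd dab).
  by rewrite SmE; exact: (rees_pos_ideal_nilpotent hdN dNab).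
- apply/seteqP; split=> [s [[[_ s_gt0]|//] [[_ s_lt0]|//]]|s ->].
    by have := lt_trans s_gt0 s_lt0; rewrite ltxx.
  by split; right.
Qed.
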